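(* Let $A\in\mathbb{R}^{n\times n}$ be symmetric, $A\neq 0$, and let $b\in\mathbb{R}^n$, $b\ne 0$. Let $\ell$ be the index at which the Lanczos process applied to $(A,b)$ terminates, and let $x_\ell$ be the final MINRES-QLP point. Then $x_\ell=x^\dagger$, where $x^\dagger$ is the unique minimum-length solution of the least-squares problem $\min_x\|Ax-b\|$.
   Context: All norms are 2-norms and exact arithmetic is assumed. The minimum-length (pseudoinverse) solution $x^\dagger$ is the unique solution of $\min\|x\|$ subject to $x\in\arg\min_{x\in\mathbb{R}^n}\|Ax-b\|$. Lanczos process: $v_0=0$, $\beta_1v_1=b$, and for $k=1,2,\dots$: $\alpha_k=v_k^TAv_k$, $\beta_{k+1}v_{k+1}=Av_k-\alpha_kv_k-\beta_kv_{k-1}$, where $\beta_k>0$ is chosen so that $\|v_k\|=1$. The process stops at the first index $k=\ell\le n$ for which $Av_\ell-\alpha_\ell v_\ell-\beta_\ell v_{\ell-1}=0$, and then $\beta_{\ell+1}=0$. Put $V_k=[v_1\ \cdots\ v_k]$ (orthonormal columns). $T_k$ is the symmetric tridiagonal $k\times k$ matrix with diagonal $\alpha_1,\dots,\alpha_k$ and off-diagonal $\beta_2,\dots,\beta_k$. For $k<\ell$, $\underline{T_k}=\begin{bmatrix}T_k\\ \beta_{k+1}e_k^T\end{bmatrix}$, so $AV_k=V_{k+1}\underline{T_k}$. Also $AV_\ell=V_\ell T_\ell$. QR step: $Q_0=1$. For $1\le k<\ell$, $Q_k=Q_{k,k+1}\begin{bmatrix}Q_{k-1}& \\ &1\end{bmatrix}$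 is orthogonal of order $k+1$. Here $Q_{k,k+1}$ is the identity except for the trailing $2\times2$ block $\begin{bmatrix}c_k & s_k \\ s_k & -c_k\end{bmatrix}$, with $c_k^2+s_k^2=1$, chosen so that $Q_k\underline{T_k}=\begin{bmatrix}R_k \\ 0\end{bmatrix}$ with $R_k$ upper triangular (three nonzero diagonals) and with positive last diagonal entry. At $k=\ell$ set $R_\ell=Q_{\ell-1}T_\ell$ (upper triangular) and $t_\ell=Q_{\ell-1}(\beta_1e_1)$. LQ step: $P_\ell$ is an orthogonal $\ell\times\ell$ matrix, a product $P_{1,2}\,P_{1,3}P_{2,3}\cdots P_{\ell-2,\ell}P_{\ell-1,\ell}$ of $2\times2$ reflectors $P_{i,j}$ acting on coordinates $i,j$, chosen so that $L_\ell=R_\ell P_\ell$ is lower triangular (three nonzero diagonals). The matrix $L_\ell$ is nonsingular if $b\in\operatorname{range}(A)$. If $b\notin\operatorname{range}(A)$, then $\operatorname{rank}(L_\ell)=\ell-1$ and the last row and column of $L_\ell$ are zero. Final MINRES-QLP point: $x_\ell=V_\ell P_\ell u_\ell$, where - if $L_\ell$ is nonsingular, $u_\ell$ is the solution of $L_\ell u_\ell=t_\ell$; - if $L_\ell$ is singular, $u_\ell=\begin{bmatrix}\tilde u \\ 0\end{bmatrix}$, where $\tilde u\in\mathbb{R}^{\ell-1}$ solves $\tilde L\tilde u=\tilde t$, $\tilde L$ is the (nonsingular) leading $(\ell-1)\times(\ell-1)$ block of $L_\ell$, and $\tilde t$ consists of the first $\ell-1$ entries of $t_\ell$. *)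

(* Defs.v *)
From HB Require Import structures.
From mathcomp Require Import all_boot all_order all_algebra.
From mathcomp Require Import reals.

Set Implicit Arguments.
Unset Strict Implicit.
Unset Printing Implicit Defensive.

Import Order.TTheory GRing.Theory Num.Theory.
Local Open Scope ring_scope.

(* Sequences are indexed as in the usual presentation (v_1, alpha_1, beta_1,
   c_1, ...; the value at index 0 is a junk value, except v_0 = 0), whereas
   matrix entries are indexed from 0 as always in MathComp.  To avoid
   dimension casts, the terminal Lanczos index is written ell = m.+1. *)

Section Norm.
Variables (R : realType) (n : nat).

Definition norm2 (x : 'cV[R]_n) : R := Num.sqrt (\sum_i x i 0 ^+ 2).

Definition lsq_solution (A : 'M[R]_n) (b x : 'cV[R]_n) : Prop :=
  forall y, norm2 (A *m x - b) <= norm2 (A *m y - b).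

Definition min_length_lsq (A : 'M[R]_n) (b x : 'cV[R]_n) : Prop :=
  lsq_solution A b x /\ forall y, lsq_solution A b y -> norm2 x <= norm2 y.

End Norm.

Section Lanczos.
Variables (R : realType) (n : nat).
Implicit Types (v : nat -> 'cV[R]_n) (alpha beta : nat -> R).

(* The Lanczos process on (A, b) stops at index ell and produces v_1, ...,
   v_ell, alpha_1, ..., alpha_ell, beta_1, ..., beta_ell.  That ell is the
   first stopping index is expressed by lanczos_step: for k < ell the residual
   is beta_(k+1) v_(k+1), which is nonzero. *)
Record lanczos (A : 'M[R]_n) (b : 'cV[R]_n) (ell : nat) v alpha beta : Prop :=
  Lanczos {
    lanczos_gt0 : (0 < ell)%N;
    lanczos_v0 : v 0%N = 0;
    lanczos_b : beta 1%N *: v 1%N = b;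
    lanczos_beta : forall k, (1 <= k <= ell)%N -> 0 < beta k;
    lanczos_norm : forall k, (1 <= k <= ell)%N -> norm2 (v k) = 1;
    lanczos_alpha : forall k, (1 <= k <= ell)%N ->
      alpha k = ((v k)^T *m A *m v k) 0 0;
    lanczos_step : forall k, (1 <= k < ell)%N ->
      beta k.+1 *: v k.+1 = A *m v k - alpha k *: v k - beta k *: v k.-1;
    lanczos_stop :
      A *m v ell - alpha ell *: v ell - beta ell *: v ell.-1 = 0;
    lanczos_beta_stop : beta ell.+1 = 0 }.

Definition Vmx v (k : nat) : 'M[R]_(n, k) := \matrix_(i, j) v j.+1 i 0.

End Lanczos.

Section QLP.
Variable R : realType.
Implicit Types (alpha beta c s : nat -> R).

(* tridiagmx alpha beta k k is T_k, and tridiagmx alpha beta k.+1 k is T_k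
   with the extra last row beta_(k+1) e_k^T. *)
Definition tridiagmx alpha beta (p q : nat) : 'M[R]_(p, q) :=
  \matrix_(i < p, j < q)
    if i == j :> nat then alpha i.+1
    else if (i == j.+1 :> nat) || (j == i.+1 :> nat) then beta (maxn i j).+1
    else 0.

(* Identity of order k, except for the block [c s; s -c] in the rows and
   columns i and j; here i and j are counted from 1. *)
Definition reflmx (k i j : nat) (c s : R) : 'M[R]_k :=
  \matrix_(p < k, q < k)
    if (p.+1 == i) && (q.+1 == i) then c
    else if (p.+1 == j) && (q.+1 == j) then - c
    else if (p.+1 == i) && (q.+1 == j) || (p.+1 == j) && (q.+1 == i) then s
    else (p == q)%:R.

(* Lower triangular, with no nonzero entry outside the main diagonal and the
   two diagonals below it. *)
Definition lower_tri3 (k : nat) (L : 'M[R]_k) : Prop :=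
  forall i j : 'I_k, ~~ (j <= i <= j + 2)%N -> L i j = 0.

Fixpoint Qmx c s (k : nat) : 'M[R]_k.+1 :=
  if k is k'.+1 then
    reflmx k'.+2 k'.+1 k'.+2 (c k'.+1) (s k'.+1)
      *m castmx (addn1 k'.+1, addn1 k'.+1) (block_mx (Qmx c s k') 0 0 1%:M)
  else 1%:M.

(* Here k = j + 1 ranges over 1 <= k < ell, [M] is Q_k times the (k+1) x k
   tridiagonal matrix, and R_k consists of the first k rows of [M]. *)
Definition qr_step alpha beta (m : nat) c s : Prop :=
  forall j, (j < m)%N ->
    let M : 'M[R]_(j.+2, j.+1) :=
      Qmx c s j.+1 *m tridiagmx alpha beta j.+2 j.+1 in
    let Rk : 'M[R]_j.+1 := row' ord_max M in
    [/\ c j.+1 ^+ 2 + s j.+1 ^+ 2 = 1,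
        row ord_max M = 0,
        lower_tri3 Rk^T
      & 0 < Rk ord_max ord_max].

Definition Rfin alpha beta c s (m : nat) : 'M[R]_m.+1 :=
  Qmx c s m *m tridiagmx alpha beta m.+1 m.+1.

Definition tfin beta c s (m : nat) : 'cV[R]_m.+1 :=
  Qmx c s m *m (beta 1%N *: delta_mx 0 0).

(* P_{1,2} (P_{1,3} P_{2,3}) (P_{2,4} P_{3,4}) ... (P_{k-2,k} P_{k-1,k}), where
   P_{i,j} is the reflector with parameters cP i j and sP i j. *)
Definition Pmx (cP sP : nat -> nat -> R) (k : nat) : 'M[R]_k :=
  \prod_(2 <= j < k.+1) \prod_(maxn 1 (j - 2) <= i < j)
    reflmx k i j (cP i j) (sP i j).

Definition Lfin alpha beta c s (cP sP : nat -> nat -> R) (m : nat) :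
    'M[R]_m.+1 :=
  Rfin alpha beta c s m *m Pmx cP sP m.+1.

Definition lq_step alpha beta (m : nat) c s (cP sP : nat -> nat -> R) : Prop :=
  (forall i j, (1 <= i < j)%N -> (j <= m.+1)%N ->
     cP i j ^+ 2 + sP i j ^+ 2 = 1)
  /\ lower_tri3 (Lfin alpha beta c s cP sP m).

Definition qlp_solution (m : nat) (L : 'M[R]_m.+1) (t u : 'cV[R]_m.+1) : Prop :=
  if L \in unitmx then L *m u = t
  else u ord_max 0 = 0 /\
       row' ord_max (col' ord_max L) *m row' ord_max u = row' ord_max t.

End QLP.

(* Main.v *)
(* Both [Q := Q_(ell-1)] and [P := P_ell] are orthogonal and [T := T_ell] is
   symmetric, so [L = Q T P] gives [T = P L^T Q].  With [y = P u], the residual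
   [T y - beta_1 e_1] equals [Q^T (L u - t)], and both [L^T (L u - t) = 0] and
   [u \in range L^T] hold: trivially if [L] is invertible, and otherwise because
   the last row and the last column of [L] vanish while [L] has rank [ell - 1]
   (the subdiagonal of [T] is positive).  Applying [V], with [A V = V T] and
   [b = V (beta_1 e_1)], one gets [A (A x - b) = 0] and [x \in range A], which
   characterise the minimum-length least-squares solution. *)
Require Import Defs.
From HB Require Import structures.
From mathcomp Require Import all_boot all_order all_algebra.
From mathcomp Require Import reals.
From mathcomp Require Import zify ring.

Set Implicit Arguments.
Unset Strict Implicit.
Unset Printing Implicit Defensive.

Import Order.TTheory GRing.Theory Num.Theory.
Local Open Scope ring_scope.

(** * Optimality certificate for the minimum-length least-squares solution *)

Section LeastSquares.
Variable R : realType.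

Lemma le_norm2 n (x y : 'cV[R]_n) :
  (norm2 x <= norm2 y) = ((x^T *m x) 0 0 <= (y^T *m y) 0 0).
Proof.
have sqE (z : 'cV[R]_n) : (z^T *m z) 0 0 = \sum_i z i 0 ^+ 2.
  by rewrite mxE; apply: eq_bigr => i _; rewrite mxE.
by rewrite !sqE /norm2 ler_sqrt // sumr_ge0 // => i _; rewrite sqr_ge0.
Qed.

Lemma sqnorm_le0 n (x : 'cV[R]_n) : (x^T *m x) 0 0 <= 0 -> x = 0.
Proof.
rewrite mxE => le0.
have ge0 i : true -> 0 <= x^T 0 i * x i 0 by rewrite mxE -expr2 sqr_ge0.
have /eqP : \sum_i x^T 0 i * x i 0 = 0.
  by apply/eqP; rewrite eq_le le0 sumr_ge0.
rewrite psumr_eq0 // => /allP x0.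
apply/matrixP => i j; rewrite ord1 mxE.
by have := x0 i (mem_index_enum i); rewrite mxE -expr2 sqrf_eq0 => /eqP.
Qed.

Lemma sqnormD_orth n (x d : 'cV[R]_n) : x^T *m d = 0 ->
  ((x + d)^T *m (x + d)) 0 0 = (x^T *m x) 0 0 + (d^T *m d) 0 0.
Proof.
move=> xd; have dx : d^T *m x = 0 by rewrite -[LHS]trmxK trmx_mul trmxK xd trmx0.
by rewrite [(x + d)^T]raddfD mulmxDl !mulmxDr xd dx add0r addr0 !mxE.
Qed.

Lemma sqnorm_ge0 n (x : 'cV[R]_n) : 0 <= (x^T *m x) 0 0.
Proof. by rewrite mxE sumr_ge0 // => i _; rewrite mxE -expr2 sqr_ge0. Qed.

(** Pythagoras twice. The normal equation makes the residual of [x] orthogonal to the range of [A],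
    so another least-squares solution [y] has [A (y - x) = 0]. As [x] lies in the range of [A^T], it
    is orthogonal to [y - x], which gives both minimality and uniqueness. *)
Lemma min_length_lsq_unique n (A : 'M[R]_n) (b x z : 'cV[R]_n) :
  A^T *m (A *m x - b) = 0 -> x = A^T *m z -> unique (min_length_lsq A b) x.
Proof.
move=> normal_eq xE.
have residualE y : ((A *m y - b)^T *m (A *m y - b)) 0 0 =
    ((A *m x - b)^T *m (A *m x - b)) 0 0
      + ((A *m (y - x))^T *m (A *m (y - x))) 0 0.
  have -> : A *m y - b = (A *m x - b) + A *m (y - x).
    by rewrite mulmxBr [RHS]addrC addrA subrK.
  apply: sqnormD_orth.
  by rewrite mulmxA -[_^T *m A]trmxK trmx_mul trmxK normal_eq trmx0 mul0mx.
have x_lsq : lsq_solution A b x.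
  by move=> y; rewrite le_norm2 (residualE y) lerDl sqnorm_ge0.
have lsqE y : lsq_solution A b y ->
    (y^T *m y) 0 0 = (x^T *m x) 0 0 + ((y - x)^T *m (y - x)) 0 0.
  move/(_ x); rewrite le_norm2 residualE gerDl => /sqnorm_le0 Ad0.
  rewrite -sqnormD_orth ?[x + _]addrC ?subrK //.
  by rewrite {1}xE trmx_mul trmxK -mulmxA Ad0 mulmx0.
split=> [|y [y_lsq /(_ x x_lsq)]].
  by split=> // y /lsqE yE; rewrite le_norm2 yE lerDl sqnorm_ge0.
rewrite le_norm2 (lsqE y) // gerDl => /sqnorm_le0 /eqP.
by rewrite subr_eq0 => /eqP.
Qed.

End LeastSquares.

(** * Orthogonality of the products of reflectors *)

Section Orthogonal.
Variable R : realType.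

Definition orthogonal_mx k (X : 'M[R]_k) := X *m X^T = 1%:M.

Lemma orthogonal_mxM k (X Y : 'M[R]_k) :
  orthogonal_mx X -> orthogonal_mx Y -> orthogonal_mx (X *m Y).
Proof.
move=> oX oY; rewrite /orthogonal_mx trmx_mul -mulmxA (mulmxA Y) oY mul1mx.
exact: oX.
Qed.

Lemma orthogonal_mx_unit k (X : 'M[R]_k) : orthogonal_mx X -> X \in unitmx.
Proof. by case/mulmx1_unit. Qed.

Lemma reflmx_orthogonal k i j (c s : R) : (0 < i < j)%N -> (j <= k)%N ->
  c ^+ 2 + s ^+ 2 = 1 -> orthogonal_mx (reflmx k i j c s).
Proof.
case: i => // i; case: j => // j /= ltij ltjk cs.
rewrite ltnS in ltij.
pose I := Ordinal (ltn_trans ltij ltjk); pose J := Ordinal ltjk.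
have IJ : (I == J) = false by apply/negbTE; rewrite neq_ltn ltij.
have JI : (J == I) = false by rewrite eq_sym IJ.
(* With [*+] of a boolean as Kronecker delta, each row is a combination of at most two unit vectors,
   so that products with it collapse in [sumE]. *)
have FE p q : reflmx k i.+1 j.+1 c s p q =
    if p == I then c *+ (I == q) + s *+ (J == q)
    else if p == J then s *+ (I == q) - c *+ (J == q) else (p == q)%:R.
  rewrite mxE !eqSS -!(inj_eq val_inj) /= ![_ == nat_of_ord q]eq_sym.
  have [pI|pI] := eqVneq (val p) i; have [pJ|pJ] := eqVneq (val p) j;
  have [qI|qI] := eqVneq (val q) i; have [qJ|qJ] := eqVneq (val q) j;
  rewrite /= ?andbF ?andbT /= ?mulr0n ?mulr1n ?add0r ?addr0 ?sub0r ?subr0 //.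
  all: try by lia.
  - by rewrite [nat_of_ord p]pI (negbTE qI).
  - by rewrite oppr0 [nat_of_ord p]pJ (negbTE qJ).
have sumE p g : \sum_r reflmx k i.+1 j.+1 c s p r * g r =
    if p == I then c * g I + s * g J
    else if p == J then s * g I - c * g J else g p :> R.
  have IJsum x y : \sum_r (x *+ (I == r) + y *+ (J == r)) * g r =
      x * g I + y * g J :> R.
    under eq_bigr do rewrite mulrDl.
    rewrite big_split [X in X + _ = _](bigD1 I) // [X in _ + X = _](bigD1 J) //.
    rewrite !eqxx !big1 /= ?addr0 //.
      by move=> r; rewrite eq_sym => /negbTE->; rewrite mul0r.
    by move=> r; rewrite eq_sym => /negbTE->; rewrite mul0r.
  under eq_bigr do rewrite FE.
  case: ifP => _; first exact: IJsum.
  case: ifP => _.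
    by under eq_bigr do rewrite -mulNrn; rewrite IJsum mulNr.
  rewrite (bigD1 p) //= eqxx mul1r big1 ?addr0 // => r.
  by rewrite eq_sym => /negbTE->; rewrite mul0r.
apply/matrixP => p q; rewrite mxE.
under eq_bigr do rewrite [_^T _ _]mxE.
rewrite sumE !FE mxE !eqxx JI IJ.
have [->|pI] := eqVneq p I; last have [->|pJ] := eqVneq p J.
- have [_|_] := eqVneq q I; last have [_|_] := eqVneq q J.
  + by rewrite /= -cs; ring.
  + by rewrite /=; ring.
  + by rewrite /=; ring.
- have [->|_] := eqVneq q I; last have [_|_] := eqVneq q J.
  + by rewrite JI /=; ring.
  + by rewrite /= -cs; ring.
  + by rewrite /=; ring.
- have [->|_] := eqVneq q I; last have [->|_] := eqVneq q J.
  + by rewrite (negbTE pI) /=; ring.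
  + by rewrite (negbTE pJ) /=; ring.
  + by rewrite eq_sym.
Qed.

(** The size [l] is a variable so that [e] can be eliminated and the cast disappears. *)
Lemma block_orthogonal_mx k l (e : (k + 1 = l)%N) (X : 'M[R]_k) :
  orthogonal_mx X -> orthogonal_mx (castmx (e, e) (block_mx X 0 0 1%:M)).
Proof.
move=> oX; case: l / e; rewrite castmx_id /orthogonal_mx.
rewrite tr_block_mx mulmx_block !trmx0 trmx1 oX.
by rewrite !mul0mx !mulmx0 mulmx1 !addr0 add0r -scalar_mx_block.
Qed.

Lemma Qmx_orthogonal (c s : nat -> R) m :
  (forall j, (j < m)%N -> c j.+1 ^+ 2 + s j.+1 ^+ 2 = 1) ->
  orthogonal_mx (Qmx c s m).
Proof.
elim: m => [_|m IHm cs]; first by rewrite /orthogonal_mx trmx1 mulmx1.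
have oQ : orthogonal_mx (Qmx c s m) by apply: IHm => j /ltnW; exact: cs.
apply: orthogonal_mxM; first by apply: reflmx_orthogonal; rewrite ?leqnn ?cs.
exact: block_orthogonal_mx.
Qed.

Lemma Pmx_orthogonal (cP sP : nat -> nat -> R) k :
  (forall i j, (1 <= i < j)%N -> (j <= k)%N -> cP i j ^+ 2 + sP i j ^+ 2 = 1) ->
  orthogonal_mx (Pmx cP sP k).
Proof.
move=> cs; rewrite /Pmx.
have o1 : orthogonal_mx (1 : 'M[R]_k) by rewrite /orthogonal_mx trmx1 mulmx1.
have oM (X Y : 'M[R]_k) :
    orthogonal_mx X -> orthogonal_mx Y -> orthogonal_mx (X * Y).
  exact: orthogonal_mxM.
rewrite big_nat; apply: big_ind => // j /andP[_ jk].
rewrite big_nat; apply: big_ind => // i /andP[]; rewrite geq_max => /andP[i0 _] ij.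
by apply: reflmx_orthogonal; rewrite ?cs ?i0.
Qed.

End Orthogonal.

(** * The tridiagonal matrix and the Lanczos relations in matrix form *)

Section Tridiagonal.
Variable R : realType.

Lemma inj_unitmx k (X : 'M[R]_k) :
  (forall z : 'cV_k, X *m z = 0 -> z = 0) -> X \in unitmx.
Proof.
move=> Xinj; rewrite -unitmx_tr -row_free_unit; apply: inj_row_free => w wX.
apply: trmx_inj; rewrite trmx0; apply: Xinj.
by rewrite -[LHS]trmxK trmx_mul trmxK wX trmx0.
Qed.

(** The three bands are disjoint, so the entry is a sum of Kronecker deltas, which distributes over
    the sums of a matrix product. *)
Lemma tridiagmxE (alpha beta : nat -> R) p q (i : 'I_p) (j : 'I_q) :
  tridiagmx alpha beta p q i j = alpha j.+1 *+ (i == j :> nat)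
    + beta j.+2 *+ (i == j.+1 :> nat) + beta j.+1 *+ (i.+1 == j :> nat).
Proof.
rewrite mxE; have [->|ij] := eqVneq (i : nat) j.
  by rewrite (ltn_eqF (ltnSn _)) (gtn_eqF (ltnSn _)) !mulr0n !addr0.
rewrite mulr0n add0r [_ == i.+1]eq_sym.
have [->|ij1] := eqVneq (i : nat) j.+1.
  rewrite (maxn_idPl (leqnSn j)).
  by rewrite (gtn_eqF (ltnW (ltnSn j.+1))) addr0.
have [<-|_] := eqVneq i.+1 (j : nat); last by rewrite addr0.
by rewrite (maxn_idPr (leqnSn i)) add0r.
Qed.

Lemma tridiagmx_tr (alpha beta : nat -> R) p :
  (tridiagmx alpha beta p p)^T = tridiagmx alpha beta p p.
Proof.
apply/matrixP => i j; rewrite !mxE maxnC orbC eq_sym.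
by case: eqVneq => [->|].
Qed.

(* Without its first row and last column, [T] is triangular with the positive
   subdiagonal of [T] as diagonal. *)
Lemma tridiagmx_inj (alpha beta : nat -> R) m (z : 'cV[R]_m) :
  (forall k, (1 <= k <= m.+1)%N -> 0 < beta k) ->
  col' ord_max (tridiagmx alpha beta m.+1 m.+1) *m z = 0 -> z = 0.
Proof.
move=> beta_gt0 Tz; pose U := row' 0 (col' ord_max (tridiagmx alpha beta m.+1 m.+1)).
have Uz : U *m z = 0.
  apply/matrixP => i j; move/matrixP/(_ (lift 0 i) j): Tz.
  rewrite !mxE => Tzi; rewrite -[RHS]Tzi.
  by apply: eq_bigr => r _; rewrite !mxE.
have UE (i j : 'I_m) :
    U i j = tridiagmx alpha beta m.+1 m.+1 (lift 0 i) (lift ord_max j).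
  by rewrite !mxE.
have U_unit : U \in unitmx.
  (* [U] is upper triangular, while [det_trig] expects a lower triangular matrix. *)
  rewrite unitmxE -det_tr det_trig.
    rewrite unitfE prodf_seq_neq0; apply/allP => i _.
    rewrite mxE UE tridiagmxE !lift0 lift_max eqxx.
    rewrite (gtn_eqF (ltnSn _)) (gtn_eqF _) // mulr0n add0r addr0.
    by rewrite gt_eqF // beta_gt0 //= ltnS ltn_ord.
  apply/is_trig_mxP => i j ij; rewrite mxE UE tridiagmxE !lift0 lift_max.
  have lt1 : (i < j.+1)%N by exact: ltnW.
  by rewrite !gtn_eqF ?mulr0n ?addr0 // ltnW.
by rewrite -[z](mulKmx U_unit) Uz mulmx0.
Qed.

Lemma lanczos_mulmx n (A : 'M[R]_n) (b : 'cV[R]_n) m v alpha beta :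
  lanczos A b m.+1 v alpha beta ->
  A *m Vmx v m.+1 = Vmx v m.+1 *m tridiagmx alpha beta m.+1 m.+1.
Proof.
case=> _ v0 _ _ _ _ step stop _; apply/matrixP => p j; rewrite [RHS]mxE.
have AvE : (A *m Vmx v m.+1) p j = (A *m v j.+1) p 0.
  by rewrite !mxE; apply: eq_bigr => r _; rewrite mxE.
under eq_bigr do rewrite tridiagmxE mxE !mulrDr.
rewrite !big_split /= (bigD1 j) //= eqxx big1 ?addr0; last first.
  by move=> r /negbTE rj; rewrite (inj_eq val_inj) rj mulr0.
(* Superdiagonal term. In the first column the sum is empty of nonzero terms, which agrees with the
   convention [v 0 = 0]. *)
have -> : \sum_(r < m.+1) v r.+1 p 0 * (beta j.+1 *+ (r.+1 == j :> nat)) =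
    beta j.+1 * v j p 0.
  case: j {AvE} => -[|j] jm /=.
    by rewrite v0 mxE mulr0 big1 // => r _; rewrite mulr0.
  rewrite (bigD1 (Ordinal (ltnW jm))) //= eqxx big1 ?addr0 1?mulrC // => r rj.
  by rewrite eqSS (negbTE (_ : r != j :> nat)) ?mulr0.
(* Only the columns before the last have a subdiagonal entry; the last column is the stopping
   equation. *)
have [jm|mj] := ltnP j m.
  rewrite (bigD1 (Ordinal (jm : j.+1 < m.+1)%N)) //= eqxx big1 ?addr0; last first.
    by move=> r rj; rewrite (negbTE (_ : r != j.+1 :> nat)) ?mulr0.
  have /matrixP/(_ p 0) := step j.+1 jm.
  rewrite AvE !mxE /= => e.
  rewrite mulr1n [X in _ + X + _]mulrC e; ring.
have jE : nat_of_ord j = m by apply/eqP; rewrite eqn_leq mj -ltnS ltn_ord.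
rewrite [X in _ + X + _]big1; last first.
  by move=> r _; rewrite (ltn_eqF (_ : r < j.+1)%N) ?mulr0 // jE.
have /matrixP/(_ p 0) := stop; rewrite AvE jE !mxE /= => /eqP.
rewrite -addrA -opprD subr_eq0 => /eqP ->; ring.
Qed.

Lemma lanczos_rhs n (A : 'M[R]_n) (b : 'cV[R]_n) m v alpha beta :
  lanczos A b m.+1 v alpha beta ->
  b = Vmx v m.+1 *m (beta 1%N *: delta_mx 0 0).
Proof.
case=> _ _ <- _ _ _ _ _ _; rewrite -scalemxAr -colE; congr (_ *: _).
by apply/matrixP => i j; rewrite !mxE ord1.
Qed.

(** The first [m] columns of the final square tridiagonal matrix form the rectangular matrix of the
    last QR step, whose last row is annihilated. *)
Lemma Rfin_last (alpha beta c s : nat -> R) m (j : 'I_m) :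
  qr_step alpha beta m c s ->
  Rfin alpha beta c s m ord_max (lift ord_max j) = 0.
Proof.
case: m j => [[]//|m] j /(_ m (ltnSn m)) /= [_ /matrixP/(_ 0 j) + _ _].
rewrite !mxE => Mj; rewrite -[RHS]Mj; apply: eq_bigr => r _; congr (_ * _).
by rewrite !tridiagmxE lift_max.
Qed.

End Tridiagonal.

(** * Optimality of [P u] for the tridiagonal problem *)

Section QLP.
Variable R : realType.

Lemma mulmx_col'_max k m (M : 'M[R]_(k, m.+1)) (z : 'cV_m.+1) :
  z ord_max 0 = 0 -> M *m z = col' ord_max M *m row' ord_max z.
Proof.
move=> z0; apply/matrixP => i j; rewrite ord1 !mxE (bigD1_ord ord_max) //=.
by rewrite z0 mulr0 add0r; apply: eq_bigr => r _; rewrite !mxE.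
Qed.

(** The conclusions are the normal equation and the range condition for the matrix [T] and
    right-hand side [Q^T t]. Through [T Q^T = P L^T] they reduce to conditions on [L] and [u]
    alone. *)
Lemma qlp_solutionP m (T Q P : 'M[R]_m.+1) (t u : 'cV_m.+1) :
  T^T = T -> orthogonal_mx Q -> orthogonal_mx P ->
  (forall j, (Q *m T) ord_max (lift ord_max j) = 0) ->
  (forall z : 'cV_m, col' ord_max T *m z = 0 -> z = 0) ->
  is_trig_mx (Q *m T *m P) -> qlp_solution (Q *m T *m P) t u ->
  T *m (T *m (P *m u) - Q^T *m t) = 0 /\ exists w, P *m u = T *m w.
Proof.
move=> symT oQ oP QTlast Tinj; set L := Q *m T *m P => L_trig u_sol.
have QtQ : Q^T *m Q = 1%:M by exact: mulmx1C.
have TQt : T *m Q^T = P *m L^T.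
  by rewrite /L !trmx_mul symT [RHS]mulmxA oP mul1mx.
have residualE : T *m (P *m u) - Q^T *m t = Q^T *m (L *m u - t).
  by rewrite mulmxBr /L !mulmxA QtQ mul1mx.
suff [Lres uL] : L^T *m (L *m u - t) = 0 /\ (u^T <= L)%MS.
  split; first by rewrite residualE mulmxA TQt -mulmxA Lres mulmx0.
  have /submxP[D uD] := uL; exists (Q^T *m D^T).
  by rewrite mulmxA TQt -mulmxA -trmx_mul -uD trmxK.
move: u_sol; rewrite /qlp_solution; case: ifPn => [L_unit Lu|L_sing [u0 Lu]].
  by rewrite Lu subrr mulmx0 submx_full // row_full_unit.
(* If this corner were nonzero, the last row of [Q T z = 0] would kill the last entry of [z], and
   [Tinj] the others, so [L] would be invertible. *)
have QTmax : (Q *m T) ord_max ord_max = 0.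
  apply: contraNeq L_sing => rho0; rewrite unitmx_mul (orthogonal_mx_unit oP) andbT.
  apply: inj_unitmx => z QTz.
  have z0 : z ord_max 0 = 0.
    have /matrixP/(_ ord_max 0) := QTz; rewrite mxE (bigD1_ord ord_max) //=.
    rewrite big1 ?addr0 => [|j _]; last by rewrite QTlast mul0r.
    by rewrite [RHS]mxE => /eqP; rewrite mulf_eq0 (negbTE rho0) => /eqP.
  have Tz : T *m z = 0 by rewrite -[T]mul1mx -QtQ -!mulmxA [Q *m _]mulmxA QTz mulmx0.
  have /matrixP z' : row' ord_max z = 0 by apply: Tinj; rewrite -mulmx_col'_max.
  apply/matrixP => i j; rewrite ord1 [RHS]mxE.
  by case: (unliftP ord_max i) => [i'|] ->//; have := z' i' 0; rewrite !mxE.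
have Lrow j : L ord_max j = 0.
  rewrite mxE big1 // => i _.
  by case: (unliftP ord_max i) => [i'|] ->; rewrite (QTlast, QTmax) mul0r.
have Lcol i : L i ord_max = 0.
  case: (unliftP ord_max i) => [i'|] ->; last exact: Lrow.
  by apply: (is_trig_mxP L_trig); rewrite lift_max.
split.
  (* The last residual entry may be nonzero, but it meets the zero last row of [L]; the other
     entries vanish by the reduced system. *)
  apply/matrixP => i j; rewrite ord1 [RHS]mxE mxE (bigD1_ord ord_max) //=.
  rewrite [L^T _ _]mxE Lrow mul0r add0r big1 // => k _.
  have /matrixP/(_ k 0) : row' ord_max (L *m u - t) = 0.
    rewrite mulmx_col'_max // [LHS]linearB /= -Lu.
    apply/eqP; rewrite subr_eq0; apply/eqP.
    by apply/matrixP => p q; rewrite !mxE; apply: eq_bigr => r _; rewrite !mxE.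
  by rewrite [LHS]mxE [RHS]mxE => ->; rewrite mulr0.
(* [L] has rank at least [m] and its rows lie in the hyperplane of vectors with
   last entry [0], hence span it. *)
pose K := kermx (delta_mx ord_max 0 : 'cV[R]_m.+1).
have subK (w : 'rV_m.+1) : w 0 ord_max = 0 -> (w <= K)%MS.
  move=> w0; apply/sub_kermxP; rewrite -colE.
  by apply/matrixP => i j; rewrite !ord1 !mxE w0.
have LK : (L <= K)%MS by apply/row_subP => i; apply: subK; rewrite mxE Lcol.
apply: submx_trans (subK _ _) _; first by rewrite mxE.
rewrite -(geq_leqif (mxrank_leqif_sup LK)).
rewrite mxrank_ker.
have -> : \rank (delta_mx ord_max 0 : 'cV[R]_m.+1) = 1%N by rewrite mxrank_delta.
rewrite subn1 /=.
(* It remains to show [m <= \rank L]: the rank of [L] bounds that of [T], whose first [m] columns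
   are independent. *)
have TE : T = Q^T *m L *m P^T by rewrite /L !mulmxA QtQ mul1mx -mulmxA oP mulmx1.
have rankT : (\rank T <= \rank L)%N.
  by rewrite TE (leq_trans (mxrankM_maxl _ _)) // mxrankM_maxr.
apply: leq_trans rankT.
have rank_col' : \rank (col' ord_max T) == m.
  rewrite -mxrank_tr; apply: inj_row_free => w wT.
  apply: trmx_inj; rewrite trmx0; apply: Tinj.
  by rewrite -[LHS]trmxK trmx_mul trmxK wT trmx0.
rewrite -[X in (X <= _)%N](eqP rank_col').
have -> : col' ord_max T = T *m col' ord_max 1%:M.
  by rewrite !col'Esub mulmx_colsub mulmx1.
exact: mxrankM_maxl.
Qed.

End QLP.

(** * Transfer from the tridiagonal problem to [A] and [b] *)

Theorem theorem5p1 (R : realType) (n : nat) (A : 'M[R]_n) (b : 'cV[R]_n)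
    (A_sym : A^T = A) (A_neq0 : A != 0) (b_neq0 : b != 0)
    (m : nat) (v : nat -> 'cV[R]_n) (alpha beta : nat -> R)
    (lanczosAb : lanczos A b m.+1 v alpha beta)
    (c s : nat -> R) (qr : qr_step alpha beta m c s)
    (cP sP : nat -> nat -> R) (lq : lq_step alpha beta m c s cP sP)
    (u : 'cV[R]_m.+1)
    (u_sol : qlp_solution (Lfin alpha beta c s cP sP m) (tfin beta c s m) u) :
  unique (min_length_lsq A b) (Vmx v m.+1 *m Pmx cP sP m.+1 *m u).
Proof.
have [csP L_tri] := lq.
have oQ : orthogonal_mx (Qmx c s m).
  by apply: Qmx_orthogonal => j /qr[].
have QtQ : (Qmx c s m)^T *m Qmx c s m = 1%:M by exact: mulmx1C.
have AV := lanczos_mulmx lanczosAb.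
have L_trig : is_trig_mx (Lfin alpha beta c s cP sP m).
  apply/is_trig_mxP => i j ij; apply: L_tri.
  by rewrite [(j <= i)%N]leqNgt ij.
have [] := qlp_solutionP (tridiagmx_tr alpha beta m.+1) oQ
    (Pmx_orthogonal csP) (fun j => Rfin_last j qr) _ L_trig u_sol.
  by move=> z; apply: tridiagmx_inj => k /(lanczos_beta lanczosAb).
rewrite /tfin [_^T *m (_ *m _)]mulmxA QtQ mul1mx => normal_eq [w wE].
(* The witness comes from [V (T w) = A (V w)]. *)
apply: (min_length_lsq_unique (z := Vmx v m.+1 *m w)); rewrite A_sym.
  rewrite [in X in _ - X](lanczos_rhs lanczosAb) -!mulmxA.
  rewrite [A *m (Vmx _ _ *m _)]mulmxA AV.
  by rewrite -mulmxA -mulmxBr [A *m _]mulmxA AV -mulmxA normal_eq mulmx0.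
by rewrite -mulmxA wE [A *m _]mulmxA AV -mulmxA.
Qed.
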